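(* Let $n\ge 6$ and let $G_{n-2}: x\mapsto x^{2^{n-2}-1}$ over $\mathbb{F}_{2^n}$. Then: - if $\gcd(n,3)=1$, $G_{n-2}$ is differentially $6$-uniform and $\delta(b)\in\{0,2,6\}$ for any $b\in\mathbb{F}_{2^n}$. Moreover, its differential spectrum is given by $$\omega_6=\begin{cases}\frac{2^{n-2}+1}{6}-\frac{K(1)}{8}&\text{for odd } n\\[2pt] \frac{2^{n-2}-4}{6}+\frac{K(1)}{8}&\text{for even } n\end{cases},\qquad \omega_2=2^{n-1}-3\omega_6,\qquad \omega_0=2^{n-1}+2\omega_6;$$ - if $3$ divides $n$, $G_{n-2}$ is differentially $8$-uniform and $\delta(b)\in\{0,2,6,8\}$ for any $b\in\mathbb{F}_{2^n}$. Moreover, its differential spectrum is given by $$\omega_8=1,\qquad \omega_6=\begin{cases}\frac{2^{n-2}-5}{6}-\frac{K(1)}{8}&\text{for odd } n\\[2pt] \frac{2^{n-2}-10}{6}+\frac{K(1)}{8}&\text{for even } n\end{cases},\qquad \omega_2=2^{n-1}-3\omega_6-4,\qquad \omega_0=2^{n-1}+2\omega_6+3.$$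
   Context: For $b\in\mathbb{F}_{2^n}$, $\delta(b)=\#\{x\in\mathbb{F}_{2^n} : G_{n-2}(x+1)+G_{n-2}(x)=b\}$. The differential spectrum is the family $\omega_i=\#\{b\in\mathbb{F}_{2^n} : \delta(b)=i\}$. The differential uniformity of a power function is $\max_{b\in\mathbb{F}_{2^n}}\delta(b)$; the function is differentially $k$-uniform if this maximum equals $k$. $K(1)$ is the Kloosterman sum $K(1)=\sum_{x\in\mathbb{F}_{2^n}}(-1)^{Tr(x^{-1}+x)}$, where $Tr$ is the absolute trace $\mathbb{F}_{2^n}\to\mathbb{F}_2$ and $x^{-1}$ is taken to be $0$ for $x=0$ (so the term $x=0$ contributes $1$). *)

(* Defs.v *)
From mathcomp Require Import all_boot all_order all_algebra all_field.

Set Implicit Arguments.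
Unset Strict Implicit.
Unset Printing Implicit Defensive.

Import GRing.Theory.
Local Open Scope ring_scope.

Definition G (F : finFieldType) (t : nat) (x : F) : F := x ^+ (2 ^ t - 1).

Definition delta (F : finFieldType) (f : F -> F) (b : F) : nat :=
  #|[set x : F | f (x + 1) + f x == b]|.

Definition omega (F : finFieldType) (f : F -> F) (i : nat) : nat :=
  #|[set b : F | delta f b == i]|.

(* Only the direction 1 is considered: this is the differential uniformity
   when [f] is a power function, the only case in which it is used. *)
Definition differential_uniformity (F : finFieldType) (f : F -> F) : nat :=
  (\max_(b : F) delta f b)%N.

Definition differentially_uniform (F : finFieldType) (f : F -> F) (k : nat) :=
  differential_uniformity f = k.

(* The absolute trace of a field of cardinality 2 ^ n, as an element of the
   prime subfield {0, 1} of F (see [abs_trace01]). *)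
Definition abs_trace (F : finFieldType) (n : nat) (x : F) : F :=
  \sum_(i < n) x ^+ (2 ^ i).

Lemma abs_trace01 (F : finFieldType) (n : nat) (cardF : #|F| = (2 ^ n)%N)
  (x : F) : abs_trace n x = 0 \/ abs_trace n x = 1.
Proof.
have ch2 : 2%N \in [pchar F] by apply: (card_finPcharP cardF).
have sqr (y : F) : y ^+ 2 = pFrobenius_aut ch2 y by [].
have trE : abs_trace n x ^+ 2 = abs_trace n x.
  rewrite sqr /abs_trace rmorph_sum /=.
  under eq_bigr do rewrite -sqr -exprM -expnSr.
  case: n cardF => [|n] cardF; first by rewrite !big_ord0.
  rewrite big_ord_recr [RHS]big_ord_recl /= -cardF expf_card addrC.
  by congr (_ + _); rewrite ?expn0 ?expr1.
have /eqP : abs_trace n x * (abs_trace n x - 1) = 0.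
  by rewrite mulrBr mulr1 -expr2 trE subrr.
by rewrite mulf_eq0 subr_eq0 => /orP[] /eqP; [left|right].
Qed.

Definition sign_trace (F : finFieldType) (n : nat) (x : F) : int :=
  (-1) ^+ (abs_trace n x == 1).

(* The value at 1 of the Kloosterman sum over a field of cardinality 2 ^ n;
   recall that 0^-1 = 0, so that the term x = 0 is 1. *)
Definition kloosterman1 (F : finFieldType) (n : nat) : int :=
  \sum_(x : F) sign_trace n (x^-1 + x).

(* Main.v *)
(** Substituting [x = y ^ 4] and [z = y ^ 2 + y] turns [G (x + 1) + G x = b]
    into [b z ^ 3 + z + 1 = 0] for a nonzero [z] with trace 0, each such [z]
    coming from two [x]; the points [x = 0, 1] add two solutions when [b = 1].
    If [z], [z'] are two such roots then so is [z + z'], hence the number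
    [m b] of roots is 0, 1 or 3 and the spectrum follows from the sums over [b]
    of [m b] and [m b ^ 2]. Pairs of distinct roots sharing their [b] are
    parametrized by [w = z' / (z + z')], with [z = w + 1/w + 1] and
    [z' = (w + 1) + 1/(w + 1) + 1]; detecting the trace conditions with the
    additive character [chi] produces the Kloosterman sum.
    That the value 6 is attained when 3 does not divide [n] requires a
    nontrivial bound on [K(1)]; the second and fourth moments of the sums
    [\sum_(x != 0) chi (a x + c / x)] over all [a], [c] suffice for [n >= 7]. *)

Require Import Defs.
From mathcomp Require Import all_boot all_order all_algebra all_field.
From mathcomp Require Import fingroup pgroup.
From mathcomp Require Import ring lra zify.

Set Implicit Arguments.
Unset Strict Implicit.
Unset Printing Implicit Defensive.

Import Order.TTheory GRing.Theory Num.Theory.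
Local Open Scope ring_scope.

Section Char2Field.

Variables (F : finFieldType) (n : nat).
Hypothesis cardF : #|F| = (2 ^ n)%N.

Local Notation q := (2 ^+ n : int).
Local Notation chi := (@sign_trace F n).

(** * Arithmetic in characteristic 2 *)

Lemma pchar2 : 2%N \in [pchar F].
Proof. exact: card_finPcharP cardF _. Qed.

Lemma degree_gt0 : (0 < n)%N.
Proof. by case: n cardF (card_finNzRing_gt1 F) => // ->. Qed.

Lemma natr_card : (#|F|%:R : int) = q.
Proof. by rewrite cardF natrX. Qed.

(** Turns an identity of characteristic 2 into one valid in every commutative ring, within reach of
    [ring]; [c] collects the terms that occur twice. *)
Lemma eq_char2 (c a b : F) : a + b = c + c -> a = b.
Proof.
rewrite (addrr_pchar2 pchar2) => ab0; apply/eqP.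
by rewrite -subr_eq0 (oppr_pchar2 pchar2) ab0.
Qed.

Lemma addr_eq0_char2 (a b : F) : (a + b == 0) = (a == b).
Proof. by rewrite -{1}(oppr_pchar2 pchar2 b) subr_eq0. Qed.

Lemma exprD_2X (k : nat) (x y : F) :
  (x + y) ^+ (2 ^ k) = x ^+ (2 ^ k) + y ^+ (2 ^ k).
Proof.
by apply: exprDn_pchar; rewrite pnatX pnatE // pchar2.
Qed.

Lemma exprX2_inj (k : nat) : injective (fun x : F => x ^+ (2 ^ k)).
Proof.
move=> x y /eqP; rewrite -addr_eq0_char2 -exprD_2X expf_eq0 expn_gt0 /=.
by rewrite addr_eq0_char2 => /eqP.
Qed.

Lemma exprX2_card (x : F) : x ^+ (2 ^ n) = x.
Proof. by rewrite -cardF expf_card. Qed.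

(** * The absolute trace and its additive character *)

Lemma abs_traceD (x y : F) :
  abs_trace n (x + y) = abs_trace n x + abs_trace n y.
Proof. by rewrite -big_split; apply: eq_bigr => i _; rewrite exprD_2X. Qed.

Lemma abs_trace_sqr (x : F) : abs_trace n (x ^+ 2) = abs_trace n x.
Proof.
rewrite /abs_trace; case: n degree_gt0 exprX2_card => // m _ frobK.
under eq_bigr do rewrite -exprM -expnS.
by rewrite big_ord_recr [RHS]big_ord_recl /= frobK expn0 expr1 addrC.
Qed.

Lemma sign_traceD (x y : F) : chi (x + y) = chi x * chi y.
Proof.
rewrite /sign_trace abs_traceD.
have [] := abs_trace01 cardF x => ->; have [] := abs_trace01 cardF y => ->;
  by rewrite ?addr0 ?add0r ?(addrr_pchar2 pchar2) ?eqxx ?[0 == 1]eq_sym ?oner_eq0.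
Qed.

Lemma sign_trace0 : chi 0 = 1.
Proof.
rewrite /sign_trace /abs_trace big1 ?[0 == 1]eq_sym ?oner_eq0 // => i _.
by rewrite expr0n expn_eq0.
Qed.

Lemma sign_trace1 : chi 1 = (-1) ^+ odd n.
Proof.
rewrite /sign_trace /abs_trace; under eq_bigr do rewrite expr1n.
rewrite sumr_const card_ord.
have -> : 1 *+ n = (odd n)%:R :> F.
  rewrite -[in LHS](odd_double_half n) natrD -muln2 natrM.
  by rewrite (pcharf0 pchar2) mulr0 addr0.
by case: (odd n); rewrite ?eqxx // mulr0n eq_sym oner_eq0.
Qed.

Lemma sign_trace_sqr (x : F) : chi (x ^+ 2) = chi x.
Proof. by rewrite /sign_trace abs_trace_sqr. Qed.

Lemma sign_trace_mulrr (x : F) : chi x * chi x = 1.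
Proof. by rewrite -sign_traceD (addrr_pchar2 pchar2) sign_trace0. Qed.

Lemma sign_trace_cases (x : F) : chi x = 1 \/ chi x = -1.
Proof. by rewrite /sign_trace; case: eqP; [right | left]. Qed.

Lemma sign_trace_sqrD (x : F) : chi (x ^+ 2 + x) = 1.
Proof. by rewrite sign_traceD sign_trace_sqr sign_trace_mulrr. Qed.

(** The trace is a nonzero polynomial of degree at most [2 ^ (n - 1)], too small to vanish on all
    [2 ^ n] elements. *)
Lemma sign_trace_nontrivial : exists x : F, chi x = -1.
Proof.
case: (pickP (fun x : F => chi x == -1)) => [x /eqP|chi1]; first by exists x.
pose p : {poly F} := \sum_(i < n) 'X^(2 ^ i).
have szp : (size p <= (2 ^ n.-1).+1)%N.
  apply: (leq_trans (size_sum _ _ _)); apply/bigmax_leqP => i _.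
  by rewrite size_polyXn ltnS leq_exp2l // -ltnS prednK ?degree_gt0.
(* Only the summand of index 0 contributes to the coefficient of ['X], which is therefore 1. *)
have p_n0 : p != 0.
  apply: contraTneq isT => /(congr1 (fun r : {poly F} => r`_1)).
  rewrite coef0 coef_sum -(prednK degree_gt0) big_ord_recl coefXn eqxx big1.
    by move/eqP; rewrite addr0 oner_eq0.
  by move=> i _; rewrite coefXn -[1%N](expn0 2) eqn_exp2l.
have rootp : all (root p) (enum F).
  apply/allP => x _; rewrite rootE /p horner_sum.
  under eq_bigr do rewrite hornerXn.
  rewrite -/(abs_trace n x); have [->//|tr1] := abs_trace01 cardF x.
  by move: (chi1 x); rewrite /sign_trace tr1 eqxx.
have := leq_trans (max_poly_roots p_n0 rootp (enum_uniq F)) szp.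
rewrite -cardE cardF ltnS leq_exp2l //.
by rewrite -[X in (X <= _)%N](prednK degree_gt0) ltnn.
Qed.

Lemma sum_sign_trace (a : F) : \sum_x chi (x * a) = if a == 0 then q else 0.
Proof.
have [->|a0] := eqVneq.
  under eq_bigr do rewrite mulr0 sign_trace0.
  by rewrite sumr_const natr_card.
have [t chit] := sign_trace_nontrivial.
have : \sum_x chi (x * a) = - \sum_x chi (x * a).
  (* Translating [x] by [t / a] multiplies every term by [chi t = -1]. *)
  rewrite {1}(reindex_inj (addIr (t * a^-1))) -mulN1r mulr_sumr.
  by apply: eq_bigr => x _; rewrite mulrDl mulfVK // sign_traceD chit mulrC.
lia.
Qed.

Lemma sum_sign_trace1 : \sum_x chi x = 0.
Proof.
by have := sum_sign_trace 1; under eq_bigr do rewrite mulr1; rewrite oner_eq0.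
Qed.

Definition artin_schreier_fiber (z : F) : {set F} :=
  [set y : F | y ^+ 2 + y == z].

(* Each fiber has at most [1 + chi z] elements, and both sides sum to [q]. *)
Lemma card_artin_schreier_fiber (z : F) :
  (#|artin_schreier_fiber z|%:R : int) = 1 + chi z.
Proof.
have le z' : (#|artin_schreier_fiber z'|%:R : int) <= 1 + chi z'.
  case: (set_0Vmem (artin_schreier_fiber z')) => [->|[y]].
    by rewrite cards0; case: (sign_trace_cases z') => ->.
  rewrite inE => /eqP <-; rewrite sign_trace_sqrD.
  suff /subset_leq_card : artin_schreier_fiber (y ^+ 2 + y) \subset [set y; y + 1].
    move/leq_trans => /(_ 2%N); rewrite cards2 => le2.
    by rewrite (ler_nat _ _ 2) le2 //; case: eqP.
  apply/subsetP => x; rewrite !inE -addr_eq0_char2.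
  have -> : x ^+ 2 + x + (y ^+ 2 + y) = (x + y) * (x + (y + 1)).
    by apply: (@eq_char2 (x ^+ 2 + x + y ^+ 2 + y + x * y)); ring.
  by rewrite mulf_eq0 !addr_eq0_char2.
have sum_eq : \sum_z' (1 + chi z' - #|artin_schreier_fiber z'|%:R) = 0.
  rewrite sumrB big_split /= sum_sign_trace1 sumr_const -natr_sum addr0.
  apply/eqP; rewrite subr_eq0; apply/eqP; congr (_%:R).
  rewrite -sum1_card (partition_big (fun y : F => y ^+ 2 + y) xpredT) //=.
  by apply: eq_bigr => z' _; rewrite sum1dep_card.
apply/esym/eqP; rewrite -subr_eq0; apply/eqP.
by apply: (psumr_eq0P _ sum_eq) => // z' _; rewrite subr_ge0 le.
Qed.

(** * Moments of Kloosterman sums and a bound on K(1) *)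

(** Expanding the square gives a sum over pairs of indices; orthogonality in [a] and in [c]
    separately keeps the pairs on which both [f] and [g] agree. *)
Lemma second_moment (I : finType) (P : pred I) (f g : I -> F) :
  \sum_a \sum_c (\sum_(i | P i) chi (a * f i + c * g i)) ^+ 2 =
  q ^+ 2 * #|[set p : I * I | [&& P p.1, P p.2, f p.1 == f p.2
                                 & g p.1 == g p.2]]|%:R.
Proof.
have sqE a c : (\sum_(i | P i) chi (a * f i + c * g i)) ^+ 2 =
  \sum_(p : I * I | P p.1 && P p.2)
     chi (a * (f p.1 + f p.2)) * chi (c * (g p.1 + g p.2)).
  rewrite expr2 big_distrlr pair_big /=; apply: eq_bigr => p _.
  by rewrite -!sign_traceD; congr (chi _); ring.
under eq_bigr do under eq_bigr do rewrite sqE.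
under eq_bigr do rewrite exchange_big.
rewrite exchange_big /=.
transitivity (\sum_(p : I * I | P p.1 && P p.2)
   if (f p.1 == f p.2) && (g p.1 == g p.2) then q ^+ 2 else 0).
  apply: eq_bigr => p _.
  under eq_bigr do rewrite -mulr_sumr sum_sign_trace addr_eq0_char2.
  rewrite -mulr_suml sum_sign_trace addr_eq0_char2 expr2.
  by do 2!case: eqP => _ /=; rewrite ?mul0r ?mulr0.
rewrite -big_mkcondr sumr_const mulr_natr; congr (_ *+ _).
by apply: eq_card => p; rewrite !inE unfold_in /= -andbA.
Qed.

Definition kloosterman_units (a c : F) : int :=
  \sum_(x | x != 0) chi (a * x + c * x^-1).

Local Notation S := kloosterman_units.

Lemma kloosterman_unitsE : S 1 1 = kloosterman1 F n - 1.
Proof.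
rewrite /kloosterman1 (bigD1 0) //= invr0 addr0 sign_trace0.
rewrite [X in _ = X]addrAC subrr add0r; apply: eq_bigr => x _.
by rewrite !mul1r addrC.
Qed.

(** Substitute [a * x] for [x]. The value [S 1 1] thus occurs [q - 1] times among the [S a c], which
    is what makes the moment bound nontrivial. *)
Lemma kloosterman_units_inv (a : F) : a != 0 -> S a a^-1 = S 1 1.
Proof.
move=> a0; rewrite /S [RHS](reindex_inj (mulfI a0)).
apply: eq_big => [x|x _]; first by rewrite mulf_eq0 (negPf a0).
by rewrite !mul1r invfM.
Qed.

Lemma card_units : (#|[pred x : F | x != 0]|%:R : int) = q - 1.
Proof.
have := cardC1 (0 : F); rewrite -(eq_card (A := [pred x : F | x != 0])) // => ->.
by rewrite -natr_card -subn1 natrB // ltnW // card_finNzRing_gt1.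
Qed.

Lemma kloosterman_units00 : S 0 0 = q - 1.
Proof.
rewrite /S -card_units -sumr_const; apply: eq_bigr => x _.
by rewrite !mul0r addr0 sign_trace0.
Qed.

Lemma sum_kloosterman_units2 :
  \sum_a \sum_c S a c ^+ 2 = q ^+ 2 * (q - 1).
Proof.
rewrite /S second_moment; congr (_ * _).
rewrite -card_units; congr _%:R.
rewrite -(card_imset [pred x : F | x != 0] (f := fun x => (x, x))).
  apply: eq_card => -[x y]; rewrite !inE /=; apply/idP/imsetP.
    by case/and4P => x0 _ /eqP <- _; exists x.
  by case=> z; rewrite inE => z0 [-> ->]; rewrite z0 !eqxx.
by move=> x y [].
Qed.

(* [x + y = x' + y'] and [1/x + 1/y = 1/x' + 1/y'] force [x = y] and
   [x' = y'], or [{x, y} = {x', y'}]. *)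
Lemma sum_kloosterman_units4 :
  \sum_a \sum_c S a c ^+ 4 <= q ^+ 2 * (3 * (q - 1) ^+ 2).
Proof.
have sqE a c : S a c ^+ 4 = (\sum_(p : F * F | (p.1 != 0) && (p.2 != 0))
    chi (a * (p.1 + p.2) + c * (p.1^-1 + p.2^-1))) ^+ 2.
  rewrite (exprM _ 2 2) /S [X in X ^+ 2 = _]expr2 big_distrlr pair_big /=.
  congr (_ ^+ 2); apply: eq_bigr => p _.
  by rewrite -!sign_traceD; congr (chi _); ring.
under eq_bigr do under eq_bigr do rewrite sqE.
rewrite (second_moment _ (fun p => p.1 + p.2) (fun p => p.1^-1 + p.2^-1)).
apply: ler_wpM2l; first by rewrite exprn_ge0 // exprn_ge0.
set N := [set _ | _].
pose U := [set p : F * F | (p.1 != 0) && (p.2 != 0)].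
have cardU : (#|U|%:R : int) = (q - 1) ^+ 2.
  have -> : U = setX [set x | x != 0] [set x | x != 0].
    by apply/setP => p; rewrite !inE.
  by rewrite cardsX natrM cardsE card_units.
pose h1 (p : F * F) := ((p.1, p.1), (p.2, p.2)).
pose h2 (p : F * F) := ((p.1, p.2), (p.1, p.2)).
pose h3 (p : F * F) := ((p.1, p.2), (p.2, p.1)).
have /subset_leq_card : N \subset h1 @: U :|: (h2 @: U :|: h3 @: U).
  apply/subsetP => -[[x y] [x' y']]; rewrite inE /=.
  case/and4P => /andP[x0 y0] /andP[x'0 y'0] /eqP sum_eq inv_eq.
  have [xy|xy] := eqVneq x y.
    rewrite !inE; apply/orP; left; apply/imsetP; exists (x, x').
      by rewrite inE x0.
    have /eqP : x' + y' = 0 by rewrite -sum_eq xy (addrr_pchar2 pchar2).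
    by rewrite addr_eq0_char2 /h1 -xy => /eqP <-.
  have prod_eq : x * y = x' * y'.
    move: inv_eq; rewrite -addr_eq0_char2.
    have -> : x^-1 + y^-1 + (x'^-1 + y'^-1) =
       (x + y) * (x' * y' + x * y) / (x * y * x' * y').
      by rewrite mulrDr {2}sum_eq; field; rewrite x0 y0 x'0 y'0.
    rewrite !mulf_eq0 invr_eq0 !mulf_eq0 addr_eq0_char2 (negPf xy).
    rewrite (negPf x0) (negPf y0) (negPf x'0) (negPf y'0) !orbF.
    by rewrite addr_eq0_char2 => /eqP.
  (* Both pairs have the same sum and product, so [x'] is a root of [(T + x) * (T + y)]. *)
  have : (x' + x) * (x' + y) == 0.
    have -> : (x' + x) * (x' + y) = x' ^+ 2 + x' * (x + y) + x * y by ring.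
    rewrite sum_eq prod_eq; apply/eqP.
    by apply: (@eq_char2 (x' ^+ 2 + x' * y')); ring.
  rewrite !inE mulf_eq0 !addr_eq0_char2 => /orP[]/eqP ex'; apply/orP; right;
    apply/orP; [left|right]; apply/imsetP; exists (x, y); rewrite ?inE ?x0 //.
    by rewrite /h2 /= ex'; rewrite ex' in sum_eq; rewrite (addrI _ sum_eq).
  rewrite /h3 /= ex'; rewrite ex' addrC in sum_eq.
  by rewrite (addrI _ sum_eq).
move=> leN.
(* The three families overlap, so this is only an upper bound. *)
have : (#|N| <= #|U| + (#|U| + #|U|))%N.
  apply: (leq_trans leN); apply: (leq_trans (leq_card_setU _ _)).
  apply: leq_add; first exact: leq_imset_card.
  apply: (leq_trans (leq_card_setU _ _)).
  by apply: leq_add; exact: leq_imset_card.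
rewrite -(ler_nat int) !natrD cardU => /le_trans; apply.
rewrite le_eqVlt; apply/orP; left; apply/eqP.
by move: (2 ^+ n : int) => Q; ring.
Qed.

(* Only the pairs [(0, 0)] and [(a, a^-1)] are kept in the sum of the
   [(S a c ^+ 2 - q) ^+ 2]. *)
Lemma kloosterman_units_bound :
  (S 1 1 ^+ 2 - q) ^+ 2 <= q ^+ 3 + 3 * q ^+ 2 - 5 * q + 1.
Proof.
pose E := \sum_a \sum_c (S a c ^+ 2 - q) ^+ 2.
have upper : E <= q ^+ 2 * (3 * (q - 1) ^+ 2) - 2 * q * (q ^+ 2 * (q - 1))
                 + q ^+ 4.
  have -> : E = \sum_a \sum_c S a c ^+ 4 - 2 * q * (\sum_a \sum_c S a c ^+ 2)
      + q ^+ 4.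
    rewrite mulr_sumr -sumrB.
    have -> : q ^+ 4 = \sum_(a : F) \sum_(c : F) q ^+ 2.
      rewrite !sumr_const -mulrnA -[RHS]mulr_natr natrM natr_card.
      by move: (2 ^+ n : int) => Q; ring.
    rewrite -big_split; apply: eq_bigr => a _ /=.
    rewrite mulr_sumr -sumrB -big_split; apply: eq_bigr => c _ /=.
    by move: (2 ^+ n : int) => Q; ring.
  by rewrite sum_kloosterman_units2 !lerD2r sum_kloosterman_units4.
have lower : ((q - 1) ^+ 2 - q) ^+ 2 + (q - 1) * (S 1 1 ^+ 2 - q) ^+ 2 <= E.
  rewrite /E (bigD1 0) //=; apply: lerD.
    rewrite (bigD1 0) //= kloosterman_units00 lerDl.
    by apply: sumr_ge0 => c _; rewrite sqr_ge0.
  rewrite -card_units -sumr_const mulr_suml.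
  apply: ler_sum => a a0; rewrite mul1r (bigD1 a^-1) //= kloosterman_units_inv //.
  by rewrite lerDl; apply: sumr_ge0 => c _; rewrite sqr_ge0.
have q_gt1 : 0 < q - 1.
  by rewrite -natr_card subr_gt0 (ltr_nat _ 1) card_finNzRing_gt1.
(* The upper bound minus the contribution of [(0, 0)] is exactly [q - 1] times the claimed
   right-hand side. *)
rewrite -(ler_pM2l q_gt1) -(lerD2l (((q - 1) ^+ 2 - q) ^+ 2)).
apply: (le_trans lower); apply: (le_trans upper).
rewrite le_eqVlt; apply/orP; left; apply/eqP.
by move: (2 ^+ n : int) => Q; ring.
Qed.

(** * Roots of trace 0 of the cubic [b * z ^ 3 + z + 1] *)

Definition trace0_roots (b : F) : {set F} :=
  [set z | [&& z != 0, b * z ^+ 3 + z + 1 == 0 & chi z == 1]].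

(** Multiplied by [z], the cubic becomes [b * z ^ 4 + z ^ 2 + z], which is additive in
    characteristic 2, as is the trace. *)
Lemma trace0_rootsD (b z z' : F) : z != z' ->
  z \in trace0_roots b -> z' \in trace0_roots b -> z + z' \in trace0_roots b.
Proof.
move=> zz'; rewrite !inE.
move=> /and3P[z0 /eqP bz /eqP cz] /and3P[z'0 /eqP bz' /eqP cz'].
rewrite sign_traceD cz cz' mulr1 eqxx andbT addr_eq0_char2 zz' /=.
have : (z + z') * (b * (z + z') ^+ 3 + (z + z') + 1) == 0.
  apply/eqP; transitivity (z * (b * z ^+ 3 + z + 1) + z' * (b * z' ^+ 3 + z' + 1)).
    apply: (@eq_char2 (b * z ^+ 4 + b * z' ^+ 4 + 2 * b * z ^+ 3 * z' +
        3 * b * z ^+ 2 * z' ^+ 2 + 2 * b * z * z' ^+ 3 +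
        z ^+ 2 + z * z' + z' ^+ 2 + z + z')); ring.
  by rewrite bz bz' !mulr0 addr0.
by rewrite mulf_eq0 addr_eq0_char2 (negPf zz').
Qed.

(** The degree gives at most 3 roots, and two distinct roots produce a third, their sum; so 2 is
    impossible. *)
Lemma card_trace0_roots (b : F) : #|trace0_roots b| \in [:: 0; 1; 3]%N.
Proof.
have le3 : (#|trace0_roots b| <= 3)%N.
  pose p := b *: 'X^3 + 'X + 1%:P.
  have p0 : p != 0.
    apply: contraTneq isT => /(congr1 (fun r : {poly F} => r`_0)).
    rewrite /p !coefD coefZ coefXn coefX coefC coef0 mulr0 !add0r.
    by move/eqP; rewrite oner_eq0.
  have szp : (size p <= 4)%N.
    rewrite /p (leq_trans (size_polyD _ _)) // geq_max.
    rewrite (leq_trans (size_polyC_leq1 _)) // andbT.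
    rewrite (leq_trans (size_polyD _ _)) // geq_max size_polyX andbT.
    by rewrite (leq_trans (size_scale_leq _ _)) // size_polyXn.
  rewrite -ltnS (leq_trans _ szp) // cardE.
  apply: max_poly_roots p0 _ (enum_uniq _); apply/allP => z.
  rewrite mem_enum inE rootE => /and3P[_ /eqP bz _].
  by rewrite /p !hornerD hornerZ hornerXn hornerX hornerC bz.
have [le1|] := leqP #|trace0_roots b| 1.
  by move: le1; case: #|_| => [|[]].
case/card_gt1P => z [z' [zM z'M zz']].
suff : (2 < #|trace0_roots b|)%N.
  by move: le3; case: #|_| => [|[|[|[]]]].
apply/card_gt2P; exists z, z', (z + z'); split; split => //.
- exact: trace0_rootsD.
- rewrite -addr_eq0_char2 addrCA (addrr_pchar2 pchar2) addr0.
  by move: zM; rewrite inE => /and3P[].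
- rewrite -addr_eq0_char2 addrAC (addrr_pchar2 pchar2) add0r.
  by move: z'M; rewrite inE => /and3P[].
Qed.

(** * First and second sums of the numbers of roots *)

Definition trace0_units : {set F} := [set z | (z != 0) && (chi z == 1)].

(** The cubic equation solved for [b]: a nonzero [z] is a root for exactly one [b]. *)
Definition root_coef (z : F) : F := (z + 1) / z ^+ 3.

Lemma trace0_rootsE (b z : F) :
  (z \in trace0_roots b) = (z \in trace0_units) && (root_coef z == b).
Proof.
rewrite !inE; have [//|z0] /= := eqVneq z 0.
rewrite andbC; congr (_ && _).
rewrite -addrA addr_eq0_char2 /root_coef -[RHS](inj_eq (mulIf (expf_neq0 3 z0))).
by rewrite divfK ?expf_neq0 // eq_sym.
Qed.

(** [1 + chi z] is 2 or 0 according to the trace, and [chi] sums to -1 over the nonzero elements. *)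
Lemma card_trace0_units : 2 * (#|trace0_units|%:R : int) = q - 2.
Proof.
have := sum_sign_trace1; rewrite (bigD1 0) //= sign_trace0 => sum0.
have -> : q - 2 = \sum_(z : F | z != 0) (1 + chi z).
  rewrite big_split /= sumr_const card_units.
  move/eqP: sum0; rewrite addrC addr_eq0 => /eqP ->.
  by rewrite -addrA -opprD.
rewrite -sumr_const mulr_sumr [RHS](bigID (fun z => chi z == 1)) /=.
rewrite [X in _ = _ + X]big1 ?addr0; last first.
  by move=> z /andP[_]; case: (sign_trace_cases z) => ->.
by apply: eq_big => z; rewrite ?inE // => /andP[_ /eqP->].
Qed.

Lemma sum_card_trace0_roots :
  \sum_b (#|trace0_roots b|%:R : int) = #|trace0_units|%:R.
Proof.
rewrite -natr_sum; congr _%:R.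
rewrite -[RHS]sum1_card [RHS](partition_big root_coef xpredT) //=.
apply: eq_bigr => b _; rewrite -sum1_card; apply: eq_bigl => z.
exact: trace0_rootsE.
Qed.

Lemma sum_sqr_card_trace0_roots :
  \sum_b (#|trace0_roots b|%:R : int) ^+ 2 =
  #|[set p : F * F | [&& p.1 \in trace0_units, p.2 \in trace0_units
                       & root_coef p.1 == root_coef p.2]]|%:R.
Proof.
under eq_bigr do rewrite -natrX.
rewrite -natr_sum; congr _%:R.
rewrite -[RHS]sum1_card [RHS](partition_big (fun p => root_coef p.1) xpredT) //=.
apply: eq_bigr => b _; rewrite expnS expn1 -cardsX -sum1_card.
apply: eq_bigl => -[z z']; rewrite in_setX /= !trace0_rootsE [in RHS]in_set /=.
case: (z \in _); case: (z' \in _) => //=; rewrite ?andbF //.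
by rewrite [RHS]andbC; case: eqP => //= <-; rewrite eq_sym.
Qed.

(** * Parametrization of pairs of distinct roots *)

(** Put [d = z + z'], [z' = w * d] and [z = (w + 1) * d]. The relation
    [z * z' * d = z ^ 2 + z * z' + z' ^ 2] between two roots then gives
    [d = (w ^ 2 + w + 1) / (w ^ 2 + w)], whence this value of [z]. *)
Definition root_param (w : F) : F := w + w^-1 + 1.

(** The first condition excludes [w = 0] and [w = 1], the second the [w] at which both parametrized
    roots vanish. *)
Definition root_param_dom : {set F} :=
  [set w | [&& w ^+ 2 + w != 0, w ^+ 2 + w != 1, chi (root_param w) == 1
             & chi (root_param (w + 1)) == 1]].

Lemma sqrD_shift (w : F) : (w + 1) ^+ 2 + (w + 1) = w ^+ 2 + w.
Proof. by apply: (@eq_char2 (w ^+ 2 + 2 * w + 1)); ring. Qed.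

Lemma sqrD_eq0 (w : F) : (w ^+ 2 + w == 0) = (w == 0) || (w + 1 == 0).
Proof. by rewrite -mulf_eq0 mulrDr mulr1 expr2. Qed.

Lemma root_paramE (w : F) : w != 0 ->
  root_param w = (w ^+ 2 + w + 1) / w.
Proof. by move=> w0; rewrite /root_param; field. Qed.

Lemma root_param1E (w : F) : w + 1 != 0 ->
  root_param (w + 1) = (w ^+ 2 + w + 1) / (w + 1).
Proof. by move=> w0; rewrite root_paramE // sqrD_shift. Qed.

(** The value depends on [w ^ 2 + w] only, hence is the same at [w + 1]: the two parametrized
    elements are roots for the same [b]. *)
Lemma root_coef_param (w : F) : w != 0 -> w ^+ 2 + w != 1 ->
  root_coef (root_param w) = (w ^+ 2 + w) ^+ 2 / (w ^+ 2 + w + 1) ^+ 3.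
Proof.
move=> w0; rewrite -addr_eq0_char2 => w1.
have param1 : root_param w + 1 = (w + 1) ^+ 2 / w.
  rewrite /root_param; apply: (@eq_char2 (w + w^-1 + 2)).
  by rewrite expr2; field.
by rewrite /root_coef param1 root_paramE //; field; rewrite w0 w1.
Qed.

(** Shows that the two roots differ, and that their sum is 1 plus the inverse of [w ^ 2 + w], the
    form used in the character sum. *)
Lemma root_paramD (w : F) : w ^+ 2 + w != 0 ->
  root_param w + root_param (w + 1) = (w ^+ 2 + w + 1) / (w ^+ 2 + w).
Proof.
rewrite sqrD_eq0 negb_or => /andP[w0 w1]; rewrite root_paramE // root_param1E //.
apply: (@eq_char2 ((w ^+ 2 + w + 1) * (w + 1) / (w ^+ 2 + w))).
have -> : w ^+ 2 + w = w * (w + 1) by ring.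
by field; rewrite w0 w1.
Qed.

(* If [z], [z'] and [z + z'] are the roots of [b * z ^ 3 + z + 1], then
   [w = z' / (z + z')] gives back [z] and [z'] as values of [root_param]. *)
Lemma sum_sqr_card_root_param :
  \sum_b (#|trace0_roots b|%:R : int) ^+ 2 =
  #|trace0_units|%:R + #|root_param_dom|%:R.
Proof.
rewrite sum_sqr_card_trace0_roots -natrD; congr _%:R.
set P := [set p | _].
pose diag (z : F) := (z, z).
pose off (w : F) := (root_param w, root_param (w + 1)).
rewrite -(cardsID [set p | p.1 == p.2] P); congr (_ + _)%N.
  rewrite -(card_imset _ (f := diag)); last by move=> z z' [].
  apply: eq_card => -[z z']; rewrite in_setI.
  rewrite [X in X && _]in_set [X in _ && X]in_set /=; apply/idP/imsetP.
    by case/andP => /and3P[zU _ _] /eqP zz'; exists z => //; rewrite /diag -zz'.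
  by case=> t tU [-> ->]; rewrite tU !eqxx.
have domP w : w \in root_param_dom -> [/\ w != 0, w + 1 != 0,
    w ^+ 2 + w != 0, w ^+ 2 + w + 1 != 0
    & (chi (root_param w) == 1) && (chi (root_param (w + 1)) == 1)].
  rewrite inE => /and3P[w20 w21 ->].
  have /andP[-> ->] : (w != 0) && (w + 1 != 0) by rewrite -negb_or -sqrD_eq0.
  by rewrite w20 addr_eq0_char2.
rewrite -(card_in_imset (f := off)); last first.
  move=> w w' /domP[w0 w1 w20 w21 _] /domP[w'0 w'1 w'20 w'21 _] [eqz eqz'].
  have paramK v : v != 0 -> v + 1 != 0 -> v ^+ 2 + v != 0 ->
      v ^+ 2 + v + 1 != 0 ->
      root_param (v + 1) / (root_param v + root_param (v + 1)) = v.
    move=> v0 v1 v20 v21; rewrite root_paramD // root_param1E //.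
    by field; rewrite v1 v20 v21.
  by rewrite -(paramK w) // -(paramK w') // eqz eqz'.
apply: eq_card => -[z z']; rewrite !inE /=; apply/idP/imsetP.
  case/andP => zz' /and3P[/andP[z0 cz] /andP[z'0 cz'] /eqP coef_eq].
  pose d := z + z'; have d0 : d != 0 by rewrite addr_eq0_char2.
  have zE : z = z' + d.
    by rewrite /d addrCA (addrr_pchar2 pchar2) addr0.
  (* Equality of the two coefficients, cross-multiplied and divided by [d]. *)
  have prodE : z * z' * d = z ^+ 2 + z * z' + z' ^+ 2.
    have coefE : (z + 1) * z' ^+ 3 = (z' + 1) * z ^+ 3.
      apply/eqP; rewrite -(inj_eq (mulIf (mulf_neq0 (invr_neq0 (expf_neq0 3 z0))
        (invr_neq0 (expf_neq0 3 z'0))))); apply/eqP.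
      transitivity (root_coef z); last rewrite coef_eq;
        by rewrite /root_coef; field; rewrite z0 z'0.
    apply: (mulfI d0); apply: (@eq_char2 ((z' + 1) * z ^+ 3 +
      z ^+ 2 * z' ^+ 2 + z ^+ 2 * z' + z * z' ^+ 2)).
    transitivity ((z + 1) * z' ^+ 3 + (z' + 1) * z ^+ 3 +
      2 * (z ^+ 2 * z' ^+ 2 + z ^+ 2 * z' + z * z' ^+ 2)).
      by rewrite /d; ring.
    by rewrite coefE; ring.
  (* [prodE] is symmetric in [z] and [z']; a statement for generic [t], [t'] serves both
     coordinates. *)
  have paramP t t' : t' != 0 -> t + t' = d ->
      t * t' * d = t ^+ 2 + t * t' + t' ^+ 2 -> root_param (t' / d) = t.
    move=> t'0 td eqt; apply: (mulIf (mulf_neq0 t'0 d0)).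
    rewrite [RHS]mulrA eqt /root_param.
    have -> : (t' / d + (t' / d)^-1 + 1) * (t' * d) = t' ^+ 2 + d ^+ 2 + t' * d.
      by field; rewrite t'0 d0.
    rewrite -td; apply: (@eq_char2 (t ^+ 2 + 2 * t * t' + 2 * t' ^+ 2)); ring.
  have w1E : z' / d + 1 = z / d.
    rewrite -[X in _ + X](divff d0) -mulrDl /d addrCA.
    by rewrite (addrr_pchar2 pchar2) addr0.
  have paramw : root_param (z' / d) = z by apply: paramP.
  have paramw1 : root_param (z' / d + 1) = z'.
    rewrite w1E; apply: paramP => //; first by rewrite addrC.
    by rewrite (mulrC z') prodE; ring.
  have w0 : z' / d != 0 by rewrite mulf_neq0 ?invr_neq0.
  exists (z' / d); last by rewrite /off paramw paramw1.
  rewrite inE sqrD_eq0 negb_or w0 paramw paramw1 cz cz' !andbT w1E.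
  rewrite mulf_neq0 ?invr_neq0 //= -addr_eq0_char2.
  apply: contraNneq z0 => w20; rewrite -paramw root_paramE //.
  by rewrite w20 mul0r.
case=> w /domP[w0 w1 w20 w21 /andP[cz cz']] [-> ->].
rewrite cz cz' !andbT -(addr_eq0_char2 (root_param w)) root_paramD //.
rewrite mulf_neq0 ?invr_neq0 //=.
have w2_n1 : w ^+ 2 + w != 1 by rewrite -addr_eq0_char2.
rewrite (root_coef_param w0 w2_n1) root_coef_param ?sqrD_shift // eqxx andbT.
by rewrite root_paramE // root_param1E // !mulf_neq0 ?invr_neq0.
Qed.

(** * Evaluation of the number of parameters by character sums *)

Lemma sum_sqrD_neq0 (H : F -> int) :
  \sum_(w | w ^+ 2 + w != 0) H w = \sum_w H w - H 0 - H 1.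
Proof.
have -> : \sum_(w | w ^+ 2 + w != 0) H w = \sum_(w | (w != 0) && (w != 1)) H w.
  by apply: eq_bigl => w; rewrite sqrD_eq0 addr_eq0_char2 negb_or.
rewrite [in RHS](bigD1 0) //= [in RHS](bigD1 1) ?oner_neq0 //=.
by ring.
Qed.

(** Group the [w] by [z = w ^ 2 + w], each fiber having [1 + chi z] elements; the sum of [chi z^-1]
    vanishes and the rest is K(1). *)
Lemma sum_sign_trace_inv_sqrD :
  \sum_w chi (w ^+ 2 + w)^-1 = kloosterman1 F n.
Proof.
rewrite (partition_big (fun w : F => w ^+ 2 + w) xpredT) //=.
transitivity (\sum_z (chi z^-1 + chi (z^-1 + z))).
  apply: eq_bigr => z _; rewrite sign_traceD -[X in X + _]mulr1 -mulrDr.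
  rewrite -card_artin_schreier_fiber mulr_natr -sumr_const.
  by apply: eq_big => w; rewrite ?inE // => /eqP->.
rewrite big_split /= -(reindex_inj (P := xpredT) (F := chi) invr_inj).
by rewrite sum_sign_trace1 add0r.
Qed.

(** The product [H w] below is 4 when both traces are 0 and 0 otherwise; once expanded, each of its
    three nonconstant terms sums to [chi 1] times K(1), up to boundary terms. *)
Lemma card_root_param_domE :
  4 * (#|root_param_dom|%:R : int) =
  q - 6 - 10 * chi 1 + 3 * chi 1 * kloosterman1 F n.
Proof.
pose H w : int := (1 + chi (root_param w)) * (1 + chi (root_param (w + 1))).
have domE : 4 * (#|root_param_dom|%:R : int) =
    \sum_(w | (w ^+ 2 + w != 0) && (w ^+ 2 + w != 1)) H w.
  rewrite (bigID (mem root_param_dom)) /= [X in _ = _ + X]big1 ?addr0.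
    rewrite -sumr_const mulr_sumr; apply: eq_big => [w|w].
      apply/idP/andP => [wd|[]//]; split=> //.
      by move: wd; rewrite inE => /and4P[-> ->].
    by rewrite /H inE => /and4P[_ _ /eqP-> /eqP->].
  move=> w /andP[/andP[w20 w21]]; rewrite inE w20 w21 /= negb_and /H.
  by case: (sign_trace_cases (root_param w)) => ->;
    case: (sign_trace_cases (root_param (w + 1))) => ->.
(* When [w ^ 2 + w = 1] both parameters vanish and [H w = 4]; there are [1 + chi 1] such [w]. *)
have fiber1 : \sum_(w | (w ^+ 2 + w != 0) && (w ^+ 2 + w == 1)) H w
    = 4 * (1 + chi 1).
  rewrite -card_artin_schreier_fiber -sumr_const mulr_sumr.
  apply: eq_big => [w|w /andP[w20 w21]].
    by rewrite inE andbC; case: eqP => //= ->; rewrite oner_neq0.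
  have [w0 w1] : w != 0 /\ w + 1 != 0.
    by apply/andP; rewrite -negb_or -sqrD_eq0.
  rewrite /H root_paramE // root_param1E // (eqP w21) (addrr_pchar2 pchar2).
  by rewrite !mul0r sign_trace0.
have -> : 4 * (#|root_param_dom|%:R : int) =
    \sum_(w | w ^+ 2 + w != 0) H w - 4 * (1 + chi 1).
  rewrite domE -fiber1 [X in _ = X - _](bigID (fun w => w ^+ 2 + w == 1)) /=.
  by rewrite addrAC subrr add0r.
have HE w : w ^+ 2 + w != 0 -> H w = 1 + chi 1 * (chi (w^-1 + w) +
    (chi ((w + 1)^-1 + (w + 1)) + chi (w ^+ 2 + w)^-1)).
  have paramE v : chi (root_param v) = chi 1 * chi (v^-1 + v).
    by rewrite /root_param sign_traceD mulrC [v + _]addrC.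
  move=> w20; transitivity (1 + chi (root_param w) + chi (root_param (w + 1)) +
      chi (root_param w + root_param (w + 1))).
    by rewrite /H (sign_traceD (root_param w)); ring.
  rewrite root_paramD // [(_ + 1) / _]mulrDl divff // mul1r.
  by rewrite (sign_traceD 1) !paramE; ring.
rewrite (eq_bigr _ HE) big_split /= -mulr_sumr !big_split /=.
(* Removing [w = 0] and [w = 1] takes 2 off each of the three sums: by [0^-1 = 0] and [1 + 1 = 0],
   every argument of [chi] there is 0. *)
rewrite !sum_sqrD_neq0 sum_sign_trace_inv_sqrD.
rewrite -(reindex_inj (P := xpredT) (F := fun w => chi (w^-1 + w)) (addIr 1)) /=.
rewrite -/(kloosterman1 F n) sumr_const natr_card add0r.
rewrite (addrr_pchar2 pchar2) expr1n expr0n /= invr0 invr1.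
rewrite !(addrr_pchar2 pchar2) !invr0 sign_trace0.
by move: (2 ^+ n : int) (chi 1) (kloosterman1 F n) => Q c K; ring.
Qed.

(** * From solutions of the differential equation to roots of the cubic *)

Lemma card_sqrD_preim (A : {set F}) : {in A, forall z, chi z = 1} ->
  #|[set y : F | y ^+ 2 + y \in A]| = (2 * #|A|)%N.
Proof.
move=> chiA; rewrite -sum1dep_card.
rewrite (partition_big (fun y : F => y ^+ 2 + y) (mem A)) //=.
rewrite mulnC -sum_nat_const; apply: eq_bigr => z zA.
apply/eqP; rewrite -(eqr_nat int) -[2%N]/(1 + 1)%N natrD -[X in _ + X](chiA z) //.
rewrite -card_artin_schreier_fiber eqr_nat -sum1dep_card; apply/eqP.
by apply: eq_bigl => y; case: eqP => [->|]; rewrite ?andbF ?zA.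
Qed.

(** The exponent [4 * (2 ^ (n - 2) - 1)] is [2 ^ n - 4], which acts as -3 on nonzero elements. At 0
    both sides are 0, since the exponent in [G] is positive for [n > 2] and [0^-1 = 0]. *)
Lemma G_exp4 (y : F) : (2 < n)%N -> @G F (n - 2) (y ^+ 4) = (y ^+ 3)^-1.
Proof.
move=> n_gt2; have [->|y0] := eqVneq y 0.
  rewrite /G !expr0n /= invr0; case: eqP => // /eqP.
  by rewrite subn_eq0 -[1%N](expn0 2) leq_exp2l // leqn0 subn_eq0 leqNgt n_gt2.
apply: (mulIf (expf_neq0 4 y0)).
rewrite /G -exprSr subn1 prednK ?expn_gt0 // -exprM -[4%N]/(2 ^ 2)%N -expnD.
rewrite subnKC ?(ltnW n_gt2) // exprX2_card.
by field.
Qed.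

Lemma deltaE (b : F) : (2 < n)%N ->
  delta (@G F (n - 2)) b = (2 * #|trace0_roots b| + 2 * (b == 1%R))%N.
Proof.
move=> n_gt2; rewrite /delta -(card_preimset _ (exprX2_inj (k := 2))).
pose D := [set y : F | ((y + 1) ^+ 3)^-1 + (y ^+ 3)^-1 == b].
pose Z := [set y : F | y ^+ 2 + y == 0].
have -> : (fun y => y ^+ (2 ^ 2)) @^-1:
    [set x | @G F (n - 2) (x + 1) + @G F (n - 2) x == b] = D.
  apply/setP => y; have := exprD_2X 2 y 1.
  by rewrite !inE expr1n => <-; rewrite !G_exp4.
have ZE : Z = [set 0; 1].
  by apply/setP => y; rewrite !inE sqrD_eq0 addr_eq0_char2.
(* Outside [Z], clearing denominators gives the cubic in [z = y ^ 2 + y], because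
   [y ^ 3 + (y + 1) ^ 3 = z + 1]. *)
rewrite -(cardsID Z D) addnC; congr (_ + _)%N.
  rewrite -card_sqrD_preim; last by move=> z; rewrite inE => /and3P[_ _ /eqP].
  apply: eq_card => y; rewrite !inE sign_trace_sqrD eqxx andbT.
  have [//|] := boolP (y ^+ 2 + y == 0); rewrite sqrD_eq0 negb_or => /andP[y0 y1] /=.
  have w0 : (y * (y + 1)) ^+ 3 != 0 by rewrite expf_neq0 // mulf_neq0.
  rewrite -(inj_eq (mulIf w0)) -(addrA (_ * _)) addr_eq0_char2 eq_sym.
  have -> : y ^+ 2 + y = y * (y + 1) by ring.
  congr (_ == _).
  rewrite (_ : (_ + _) * _ = y ^+ 3 + (y + 1) ^+ 3); last by field; rewrite y0 y1.
  by apply: (@eq_char2 (y ^+ 3 + 2 * y ^+ 2 + 2 * y + 1)); ring.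
(* At [y = 0] and [y = 1] the left-hand side is 1, since [0^-1 = 0]. *)
have -> : D :&: Z = if b == 1 then Z else set0.
  apply/setP => y; rewrite in_setI ZE !inE.
  have [->|b1] := eqVneq b 1.
    rewrite !inE andbC; case: eqP => [->|_] /=.
      by rewrite add0r expr1n expr0n invr0 invr1 addr0 eqxx.
    case: eqP => //= ->.
    by rewrite (addrr_pchar2 pchar2) expr1n expr0n invr0 invr1 add0r eqxx.
  rewrite inE andbC; case: eqP => [->|_] /=.
    by rewrite add0r expr1n expr0n invr0 invr1 addr0 eq_sym; apply/negbTE.
  case: eqP => //= ->.
  rewrite (addrr_pchar2 pchar2) expr1n expr0n invr0 invr1 add0r eq_sym.
  exact/negbTE.
by case: (b == 1); rewrite ?cards0 // ZE cards2 eq_sym oner_eq0.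
Qed.

(** * The exceptional value [b = 1] *)

Lemma one_notin_trace0_roots1 : (1 \in trace0_roots 1) = false.
Proof.
by rewrite inE expr1n mul1r (addrr_pchar2 pchar2) add0r !oner_eq0.
Qed.

(** Modulo 2, [z ^ 3 + z + 1] divides [z ^ 8 + z] with cofactor [z * (z ^ 4 + z ^ 2 + z + 1)]; [c]
    accounts for the doubled terms. *)
Lemma trace0_roots1_exp8 (z : F) : z \in trace0_roots 1 -> z ^+ 8 = z.
Proof.
rewrite inE mul1r => /and3P[_ /eqP root _].
pose c := - (z ^+ 6 + z ^+ 5 + z ^+ 4 + z ^+ 3 + z ^+ 2).
apply: (@eq_char2 c).
transitivity (z * (z ^+ 4 + z ^+ 2 + z + 1) * (z ^+ 3 + z + 1) + (c + c)).
  by rewrite /c; ring.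
by rewrite root mulr0 add0r.
Qed.

(** A root is fixed by the third and the [n]-th iterates of squaring, hence by squaring itself;
    being nonzero it would be 1, which is not a root. *)
Lemma card_trace0_roots1_ndvd3 : ~~ (3 %| n)%N -> #|trace0_roots 1| = 0%N.
Proof.
move=> n3; apply/eqP; rewrite cards_eq0; apply/eqP/setP => z; rewrite [RHS]inE.
apply/negP => zM; have z8 := trace0_roots1_exp8 zM.
have z8k k : z ^+ (2 ^ (k * 3)) = z.
  by elim: k => [|k IHk]; rewrite ?expr1 // mulSn expnD exprM z8 IHk.
have z0 : z != 0 by move: zM; rewrite inE => /and3P[].
suff z2 : z ^+ 2 = z.
  have z1 : z = 1 by apply: (mulfI z0); rewrite mulr1 -expr2.
  by rewrite z1 one_notin_trace0_roots1 in zM.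
have := exprX2_card z; rewrite {1}(divn_eq n 3) expnD exprM z8k.
move: n3; rewrite /dvdn; have := ltn_pmod n (isT : (0 < 3)%N).
(* Remainder 1 gives [z ^ 2 = z] at once; for remainder 2, square [z ^ 4 = z] and use
   [z ^ 8 = z]. *)
case: (n %% 3)%N => [|[|[|]]] // _ _ z4.
by rewrite -{1}z4 -exprM z8.
Qed.

(** For [z = y ^ 2 + y], the sum [z ^ 4 + z ^ 2 + z] telescopes to [y ^ 8 + y]. *)
Lemma trace0_roots1_sqrD (y : F) : y ^+ 8 = y -> y != 0 -> y + 1 != 0 ->
  y ^+ 2 + y \in trace0_roots 1.
Proof.
move=> y8 y0 y1; have w20 : y ^+ 2 + y != 0.
  by rewrite sqrD_eq0 negb_or y0 y1.
rewrite inE w20 sign_trace_sqrD eqxx andbT mul1r /=.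
rewrite -(inj_eq (mulfI w20)) mulr0; apply/eqP.
transitivity (y ^+ 8 + y); last by rewrite y8 (addrr_pchar2 pchar2).
by apply: (@eq_char2 (y ^+ 8 + 2 * y ^+ 7 + 3 * y ^+ 6 + 2 * y ^+ 5 + y ^+ 4 +
  y ^+ 3 + y ^+ 2 + y)); ring.
Qed.

(** [7 = 2 ^ 3 - 1] divides [2 ^ n - 1], so Cauchy's theorem gives a unit of order 7. *)
Lemma exists_exp8 : (3 %| n)%N -> exists y : F, [/\ y ^+ 8 = y, y != 0 & y != 1].
Proof.
move=> n3; have dvd7 : (7 %| #|[set: {unit F}]|)%N.
  rewrite card_finField_unit cardF -(divnK n3) mulnC expnM.
  by rewrite predn_exp dvdn_mulr.
have [//|u _ ou] := Cauchy _ dvd7.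
exists (val u); split.
- by rewrite exprS -FinRing.val_unitX -ou expg_order mulr1.
- by rewrite -unitfE (valP u).
apply/eqP => u1; move: ou; suff -> : u = 1%g by rewrite order1.
exact: val_inj.
Qed.

Lemma card_trace0_roots1_dvd3 : (3 %| n)%N -> #|trace0_roots 1| = 3%N.
Proof.
case/exists_exp8 => y [y8 y0 y1]; rewrite -addr_eq0_char2 in y1.
have zM := trace0_roots1_sqrD y8 y0 y1.
have z'M : (y ^+ 2) ^+ 2 + y ^+ 2 \in trace0_roots 1.
  apply: trace0_roots1_sqrD; rewrite ?expf_neq0 //.
    by rewrite -exprM mulnC exprM y8.
  by have := exprD_2X 1 y 1; rewrite expr1n => <-; rewrite expf_neq0.
(* The second root is the square of the first; if they were equal, the root would be 1. *)
have zz' : y ^+ 2 + y != (y ^+ 2) ^+ 2 + y ^+ 2.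
  apply: contraTneq zM => eqz; have z0 : y ^+ 2 + y != 0.
    by rewrite sqrD_eq0 negb_or y0 y1.
  suff -> : y ^+ 2 + y = 1 by rewrite one_notin_trace0_roots1.
  apply: (mulfI z0); rewrite mulr1 {3}eqz.
  by apply: (@eq_char2 (y ^+ 4 + y ^+ 3 + y ^+ 2)); ring.
have : (1 < #|trace0_roots 1%R|)%N.
  by apply/card_gt1P; exists (y ^+ 2 + y), ((y ^+ 2) ^+ 2 + y ^+ 2).
by have := card_trace0_roots 1; rewrite !inE => /or3P[]/eqP->.
Qed.

(** * Distribution of the number of roots *)

Definition root_count (i : nat) : nat := #|[set b | #|trace0_roots b| == i]|.

Lemma sum_root_count (H : nat -> int) :
  \sum_b H #|trace0_roots b| = (root_count 0)%:R * H 0%N +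
    (root_count 1)%:R * H 1%N + (root_count 3)%:R * H 3%N.
Proof.
have indE i : (root_count i)%:R * H i = \sum_b (#|trace0_roots b| == i)%:R * H i.
  rewrite -mulr_suml -natr_sum -big_mkcond /=; congr (_%:R * _).
  by rewrite sum1dep_card.
rewrite !indE -!big_split; apply: eq_bigr => b _ /=.
by have := card_trace0_roots b; rewrite !inE => /or3P[]/eqP->;
  rewrite !mul0r !mul1r ?addr0 ?add0r.
Qed.

(** [m ^ 2 - m] is 0 for [m = 0, 1] and 6 for [m = 3], so the domain of parameters has
    [6 * root_count 3] elements. *)
Lemma root_count3 :
  24 * ((root_count 3)%:R : int) =
  q - 6 - 10 * chi 1 + 3 * chi 1 * kloosterman1 F n.
Proof.
have := sum_sqr_card_root_param; rewrite -sum_card_trace0_roots.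
rewrite (sum_root_count (fun m => m%:R ^+ 2)) (sum_root_count (fun m => m%:R)).
rewrite -card_root_param_domE.
by move: (root_count 0) (root_count 1) (root_count 3) => *; lia.
Qed.

Lemma root_count1 :
  2 * ((root_count 1)%:R : int) = q - 2 - 6 * (root_count 3)%:R.
Proof.
have := card_trace0_units; rewrite -sum_card_trace0_roots.
rewrite (sum_root_count (fun m => m%:R)).
move: (2 ^+ n : int) (root_count 0) (root_count 1) (root_count 3) => *; lia.
Qed.

Lemma root_count0 :
  ((root_count 0)%:R : int) = q - (root_count 1)%:R - (root_count 3)%:R.
Proof.
have := sum_root_count (fun=> 1); rewrite sumr_const natr_card.
move: (2 ^+ n : int) (root_count 0) (root_count 1) (root_count 3) => *; lia.
Qed.

(** Otherwise K(1) would have size about [q / 3], whereas the moment bound allows only the order of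
    [q ^ (3/4)]. *)
Lemma root_count3_gt0 : (7 <= n)%N -> (0 < root_count 3)%N.
Proof.
move=> n7; rewrite lt0n; apply: contraTneq isT => count0.
have := root_count3; rewrite count0 mulr0 sign_trace1.
have := kloosterman_units_bound; rewrite kloosterman_unitsE.
move: (kloosterman1 F n) => K.
have [nodd|neven] := boolP (odd n); rewrite ?expr1 ?expr0.
  have : q >= 2 ^+ 7 by rewrite ler_weXn2l.
  move: (2 ^+ n : int) => Q Q_ge bound eqK.
  have QE : Q = 3 * K - 4 by lia.
  have K_ge : 0 <= K - 44 by lia.
  move: bound; rewrite QE; nia.
(* Even [n >= 7] means [n >= 8]. *)
have : q >= 2 ^+ 8.
  by rewrite ler_weXn2l // ltn_neqAle n7 andbT; apply: contraNneq neven => <-.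
move: (2 ^+ n : int) => Q Q_ge bound eqK.
have QE : Q = 16 - 3 * K by lia.
have K_ge : K <= -80 by lia.
move: bound; rewrite QE; nia.
Qed.

Lemma root_count_other (i : nat) : i \notin [:: 0; 1; 3]%N -> root_count i = 0%N.
Proof.
move=> ni; apply/eqP; rewrite cards_eq0; apply/eqP/setP => b; rewrite !inE.
by apply: contraNF ni => /eqP <-; exact: card_trace0_roots.
Qed.

(** * The differential spectrum *)

(** [delta] is twice the number of roots except at [b = 1], where that number is raised by one.
    Correction terms on both sides avoid truncated subtraction. *)
Lemma omega_double (j : nat) : (2 < n)%N ->
  (omega (@G F (n - 2)) (2 * j) + (#|trace0_roots 1%R| == j) =
   root_count j + (#|trace0_roots 1%R|.+1 == j))%N.
Proof.
move=> n_gt2; rewrite /omega /root_count (cardsD1 1) [X in (_ = X + _)%N](cardsD1 1).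
rewrite !inE deltaE // eqxx -mulnDr addn1 eqn_pmul2l //.
rewrite addnAC [RHS]addnAC; congr (_ + _)%N; first exact: addnC.
apply: eq_card => b; rewrite !inE deltaE //; case: eqP => //= _.
by rewrite muln0 addn0 eqn_pmul2l.
Qed.

(** At [b = 1] the value is [2 * 3 + 2 = 8] or [2 * 0 + 2 = 2], according to whether 3 divides
    [n]. *)
Lemma delta_mem (b : F) : (2 < n)%N ->
  delta (@G F (n - 2)) b \in
    if (3 %| n)%N then [:: 0; 2; 6; 8]%N else [:: 0; 2; 6]%N.
Proof.
move=> n_gt2; rewrite deltaE //.
have [->|_] := eqVneq b 1; last first.
  by have := card_trace0_roots b; rewrite !inE => /or3P[]/eqP->; case: ifP.
by case: ifP => [/card_trace0_roots1_dvd3|/negbT/card_trace0_roots1_ndvd3] ->.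
Qed.

Lemma root_counts_rat :
  let K1 : rat := (kloosterman1 F n)%:~R in
  [/\ (root_count 3)%:R = (if odd n then (2 ^+ n + 4) / 24 - K1 / 8
                           else (2 ^+ n - 16) / 24 + K1 / 8) :> rat,
      (root_count 1)%:R = 2 ^+ n / 2 - 1 - 3 * (root_count 3)%:R :> rat
    & (root_count 0)%:R = 2 ^+ n / 2 + 1 + 2 * (root_count 3)%:R :> rat].
Proof.
move=> K1.
have intr_eq (x y : int) : x = y -> x%:~R = y%:~R :> rat by move->.
have := intr_eq _ _ root_count3; have := intr_eq _ _ root_count1.
have := intr_eq _ _ root_count0.
rewrite sign_trace1 !(rmorphD, rmorphN, rmorphM, rmorphXn, rmorph_nat,
  rmorph1) /= -/K1.
move: (root_count 0)%:R (root_count 1)%:R (root_count 3)%:R (2 ^+ n) K1.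
move=> A0 A1 A3 Q K e0 e1 e3.
by case: (odd n) e3 => /= e3; rewrite ?expr1 ?expr0 in e3; split; lra.
Qed.

End Char2Field.

Theorem corollary5 (F : finFieldType) (n : nat) (cardF : #|F| = (2 ^ n)%N)
    (n_ge6 : (6 <= n)%N) :
  let g : F -> F := @G F (n - 2) in
  let K1 : rat := (kloosterman1 F n)%:~R in
  let w (i : nat) : rat := (omega g i)%:R in
  (gcdn n 3 = 1%N ->
     [/\ differentially_uniform g 6,
         forall b : F, delta g b \in [:: 0; 2; 6]%N,
         w 6%N = (if odd n then (2 ^+ (n - 2) + 1) / 6 - K1 / 8
                  else (2 ^+ (n - 2) - 4) / 6 + K1 / 8),
         w 2%N = 2 ^+ (n - 1) - 3 * w 6%N
       & w 0%N = 2 ^+ (n - 1) + 2 * w 6%N])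
  /\
  ((3 %| n)%N ->
     differentially_uniform g 8 /\
     [/\ forall b : F, delta g b \in [:: 0; 2; 6; 8]%N,
         w 8%N = 1,
         w 6%N = (if odd n then (2 ^+ (n - 2) - 5) / 6 - K1 / 8
                  else (2 ^+ (n - 2) - 10) / 6 + K1 / 8),
         w 2%N = 2 ^+ (n - 1) - 3 * w 6%N - 4
       & w 0%N = 2 ^+ (n - 1) + 2 * w 6%N + 3]).
Proof.
move=> g K1 w.
have n_gt2 : (2 < n)%N by apply: leq_trans n_ge6.
have [count3 count1 count0] := root_counts_rat cardF.
have omegaE j := omega_double cardF j n_gt2.
have delta_in b := delta_mem cardF b n_gt2.
have pow_n : 2 ^+ n = 4 * 2 ^+ (n - 2) :> rat.
  by rewrite -{1}(subnK (ltnW n_gt2)) exprD mulrC.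
have pow_n1 : 2 ^+ (n - 1) = 2 * 2 ^+ (n - 2) :> rat.
  by rewrite -exprS; congr (_ ^+ _); lia.
rewrite /w; split=> [/eqP n3|n3].
  have {}n3 : ~~ (3 %| n)%N.
    by rewrite -prime_coprime // coprime_sym.
  (* Here [b = 1] has no root but [delta] equal to 2, so it passes from the class of 0 to that of
     2. *)
  have [m6 [m2 m0]] : omega g 6 = root_count F n 3 /\
      omega g 2 = (root_count F n 1).+1 /\ root_count F n 0 = (omega g 0).+1.
    have := (omegaE 0%N, omegaE 1%N, omegaE 3%N).
    rewrite (card_trace0_roots1_ndvd3 cardF n3) /= !muln0 !addn0 addn1.
    by case=> -[<- ->] ->; rewrite addn1.
  have delta3 b : delta g b \in [:: 0; 2; 6]%N.
    by have := delta_in b; rewrite (negPf n3).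
  split=> //.
  - rewrite /differentially_uniform /differential_uniformity.
    apply/eqP; rewrite eqn_leq; apply/andP; split.
      apply/bigmax_leqP => b _.
      by have := delta3 b; rewrite !inE => /or3P[]/eqP->.
    have : (0 < omega g 6)%N.
      (* The case [n = 6] is ruled out because 3 divides 6. *)
      rewrite m6 root_count3_gt0 // ltn_neqAle n_ge6 andbT.
      by apply: contraNneq n3 => <-.
    case/card_gt0P => b; rewrite inE => /eqP <-.
    exact: (leq_bigmax (F := delta g) b).
  - by rewrite m6 count3 pow_n; case: ifP => _; lra.
  - by rewrite m2 m6 -natr1 count1 pow_n pow_n1; lra.
  move: count0; rewrite m0 m6 pow_n pow_n1 -natr1 => count0; lra.
(* Here [b = 1] passes from the class of 6 to that of 8, of which it is the only member. *)
have [m8 [m6 [m2 m0]]] : omega g 8 = 1%N /\ root_count F n 3 = (omega g 6).+1 /\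
    omega g 2 = root_count F n 1 /\ omega g 0 = root_count F n 0.
  have := (omegaE 0%N, omegaE 1%N, omegaE 3%N, omegaE 4%N).
  rewrite (card_trace0_roots1_dvd3 cardF n3) /= !muln0 !addn0 addn1.
  by rewrite (root_count_other cardF (i := 4)) //; case=> -[[-> ->] ->] ->.
have delta4 b : delta g b \in [:: 0; 2; 6; 8]%N.
  by have := delta_in b; rewrite n3.
split; last split=> //.
- rewrite /differentially_uniform /differential_uniformity.
  apply/eqP; rewrite eqn_leq; apply/andP; split.
    apply/bigmax_leqP => b _.
    by have := delta4 b; rewrite !inE => /or4P[]/eqP->.
  have : (0 < omega g 8)%N by rewrite m8.
  case/card_gt0P => b; rewrite inE => /eqP <-.
  exact: (leq_bigmax (F := delta g) b).
- by rewrite m8.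
- move: count3; rewrite m6 pow_n -natr1; case: ifP => _ count3; lra.
- by rewrite m2 count1 m6 pow_n pow_n1 -natr1; lra.
by rewrite m0 count0 m6 pow_n pow_n1 -natr1; lra.
Qed.
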